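(* Let $d,n$ be positive integers and $0\le k\le n$ an integer. Then $$\left\langle \begin{matrix} n\\ k\end{matrix}\right\rangle_d=\det\left(\binom{n+d+j-i-1}{n-1}\right)_{i,j=0}^{k-1}.$$
   Context: For a positive integer $d$ and integer $m\ge0$, $\langle m\rangle_d=\binom{m+d-1}{d}$. For $0\le k\le n$, $\left\langle \begin{matrix} n\\ k\end{matrix}\right\rangle_d=\prod_{j=0}^{k-1}\frac{\langle n-j\rangle_d}{\langle k-j\rangle_d}$. A $0\times0$ determinant equals $1$; $\binom{a}{m}=0$ if $m>a$. *)

(* Defs.v *)
From mathcomp Require Import all_boot all_order all_algebra.

Set Implicit Arguments.
Unset Strict Implicit.
Unset Printing Implicit Defensive.

Import Order.TTheory GRing.Theory Num.Theory.
Local Open Scope ring_scope.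

(* Intended for 0 < d, so that the truncated subtraction m + d - 1 is exact. *)
Definition angle (d m : nat) : nat := 'C(m + d - 1, d).

(* Intended for k <= n. The quotients are taken in rat because an individual
   factor need not be an integer; the denominators are nonzero since j < k. *)
Definition angle_binomial (d n k : nat) : rat :=
  \prod_(0 <= j < k) ((angle d (n - j))%:R / (angle d (k - j))%:R).

(* Main.v *)
(** Write [n = k + r].  By Vandermonde's convolution the matrix is the product of
    [('C(d + k + r - 1 - i, k + r - 1 - j))] and the unitriangular matrix
    [('C(j, i))].  Extracting factors from the rows and columns by
    [m * 'C(m - 1, p - 1) = p * 'C(m, p)] lowers [r] by one, with the same ratio
    [\prod_(j < k) (d + r + 1 + j) / (r + 1 + j)] as for the generalized binomial
    coefficient.  For [r = 0] both sides are [1], the matrix being, by a second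
    Vandermonde convolution, a product of two unitriangular matrices. *)

Require Import Defs.
From mathcomp Require Import all_boot all_order all_algebra.
From mathcomp Require Import zify.

Set Implicit Arguments.
Unset Strict Implicit.
Unset Printing Implicit Defensive.

Import Order.TTheory GRing.Theory Num.Theory.
Local Open Scope ring_scope.

(** Vandermonde's sum runs over [l <= q]; the terms with [l >= k] vanish since [m < k]. Stopping at
    [k] makes it an entry of a product of [k] by [k] matrices. *)
Lemma Vandermonde_trunc (m p k q : nat) : (m < k <= q.+1)%N ->
  (\sum_(l < k) 'C(p, q - l) * 'C(m, l) = 'C(p + m, q))%N.
Proof.
case/andP=> mk kq; rewrite addnC -binomial.Vandermonde.
rewrite (big_ord_widen _ (fun l => 'C(p, q - l) * 'C(m, l))%N kq).
rewrite big_mkcond; apply: eq_bigr => l _; case: ifP => [_|lk].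
  exact: mulnC.
by rewrite bin_small //; lia.
Qed.

(** Substituting [l + j] for [l] gives Vandermonde's convolution at [q - j]. *)
Lemma Vandermonde_shift (m p j q : nat) : (j <= q)%N ->
  (\sum_(j <= l < q.+1) 'C(p, q - l) * 'C(m, l - j) = 'C(p + m, q - j))%N.
Proof.
move=> jq; rewrite addnC -binomial.Vandermonde -{1}[j]add0n big_addn subSn //.
rewrite big_mkord; apply: eq_bigr => l _.
by rewrite addnK mulnC addnC subnDA.
Qed.

Section UnitriangularDet.
Variable R : comNzRingType.

Lemma det_unitrig (k : nat) (A : 'M[R]_k) :
  (forall i j : 'I_k, (i < j)%N -> A i j = 0) -> (forall i, A i i = 1) ->
  \det A = 1.
Proof.
move=> A0 A1; rewrite det_trig; first by rewrite big1.
by apply/is_trig_mxP.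
Qed.

Lemma det_unitrig_upper (k : nat) (A : 'M[R]_k) :
  (forall i j : 'I_k, (j < i)%N -> A i j = 0) -> (forall i, A i i = 1) ->
  \det A = 1.
Proof.
move=> A0 A1; rewrite -det_tr; apply: det_unitrig => [i j ij|i]; rewrite mxE //.
exact: A0.
Qed.

End UnitriangularDet.

Definition binmx (d n k : nat) : 'M[rat]_k :=
  \matrix_(i, j) 'C(d + n - i.+1, n - j.+1)%:R.

Lemma det_toeplitz_bin (d n k : nat) : (k <= n)%N ->
  \det (\matrix_(i < k, j < k) ('C(n + d + j - i - 1, n - 1)%:R : rat)) =
  \det (binmx d n k).
Proof.
move=> kn; pose U : 'M[rat]_k := \matrix_(i, j) 'C(j, i)%:R.
have detU : \det U = 1.
  by apply: det_unitrig_upper => [i j ij|i]; rewrite mxE ?binn // bin_small.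
rewrite -[RHS]mulr1 -[X in _ = _ * X]detU -det_mulmx; congr (\det _).
apply/matrixP=> i j; rewrite !mxE; have [ik jk] := (ltn_ord i, ltn_ord j).
have -> : (n + d + j - i - 1 = d + n - i.+1 + j)%N by lia.
rewrite -(@Vandermonde_trunc j _ k); last by lia.
rewrite natr_sum; apply: eq_bigr => l _; rewrite !mxE natrM.
by congr ('C(_, _)%:R * _); lia.
Qed.

Lemma det_binmx_diag (d k : nat) : \det (binmx d k k) = 1.
Proof.
pose U : 'M[rat]_k := \matrix_(i, j) 'C(k - i.+1, k - j.+1)%:R.
(* The guard matters: above the diagonal [i - j] truncates to [0], and the binomial would be [1]
   instead of [0]. *)
pose L : 'M[rat]_k := \matrix_(i, j) (if (j <= i)%N then 'C(d, i - j)%:R else 0).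
have detU : \det U = 1.
  apply: det_unitrig_upper => [i j ij|i]; rewrite mxE ?binn // bin_small //.
  by have := ltn_ord i; lia.
have detL : \det L = 1.
  by apply: det_unitrig => [i j|i]; rewrite mxE ?leqnn ?subnn ?bin0 // ltnNge => /negPf->.
rewrite -[RHS]mulr1 -[X in _ = X * _]detU -[X in _ = _ * X]detL -det_mulmx; congr (\det _).
apply/matrixP=> i j; rewrite !mxE; have [ik jk] := (ltn_ord i, ltn_ord j).
have -> : (d + k - i.+1 = k - i.+1 + d)%N by lia.
have -> : (k - j.+1 = k.-1 - j)%N by lia.
rewrite -Vandermonde_shift; last by lia.
(* The lower summation bound [j <= l] becomes the guard in [L]. *)
rewrite (ltn_predK ik) big_geq_mkord natr_sum big_mkcond.
apply: eq_bigr => l _; rewrite !mxE /=; case: ifP => _; last by rewrite mulr0.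
by rewrite natrM; congr ('C(_, _)%:R * _); lia.
Qed.

Lemma det_binmxS (d n k : nat) : (k <= n)%N ->
  \det (binmx d n.+1 k) =
  \prod_(0 <= j < k) ((d + n - j)%:R / (n - j)%:R) * \det (binmx d n k).
Proof.
move=> kn.
(* Row and column factors come from [(n - j) * 'C(d + n - i, n - j) = (d + n - i) * 'C(d + n - i -
   1, n - j - 1)]. *)
pose u : 'rV[rat]_k := \row_i (d + n - i)%:R.
pose v : 'rV[rat]_k := \row_j (n - j)%:R^-1.
have -> : binmx d n.+1 k = diag_mx u *m binmx d n k *m diag_mx v.
  apply/matrixP=> i j; rewrite mul_mx_diag mul_diag_mx !mxE.
  have [ik jk] := (ltn_ord i, ltn_ord j).
  have nj0 : (n - j)%:R != 0 :> rat by rewrite pnatr_eq0; lia.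
  apply: (canRL (mulfK nj0)); rewrite -!natrM; congr _%:R.
  have -> : (d + n.+1 - i.+1 = (d + n - i.+1).+1)%N by lia.
  have -> : (d + n - i = (d + n - i.+1).+1)%N by lia.
  have -> : (n.+1 - j.+1 = (n - j.+1).+1)%N by lia.
  have -> : (n - j = (n - j.+1).+1)%N by lia.
  by rewrite mul_bin_diag mulnC.
rewrite !det_mulmx !det_diag big_mkord big_split /= mulrAC.
by congr (_ * _ * _); apply: eq_bigr => i _; rewrite mxE.
Qed.

Lemma angle_gt0 (d m : nat) : (0 < m)%N -> (0 < angle d m)%N.
Proof. by move=> m0; rewrite bin_gt0; lia. Qed.

Lemma angleS (d m : nat) : (0 < m)%N ->
  (m * angle d m.+1 = (d + m) * angle d m)%N.
Proof.
case: m => // m _; rewrite /angle.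
have -> : (m.+2 + d - 1 = (m + d).+1)%N by lia.
have -> : (m.+1 + d - 1 = m + d)%N by lia.
have := mul_bin_down (m + d).+1 d; rewrite subSn ?leq_addl // addnK /= => <-.
by congr (_ * _)%N; lia.
Qed.

Lemma angle_binomial_diag (d k : nat) : angle_binomial d k k = 1.
Proof.
rewrite /angle_binomial big_mkord big1 // => j _; rewrite divff // pnatr_eq0.
by rewrite -lt0n angle_gt0 // subn_gt0.
Qed.

(** Only the numerators depend on [n]; each changes by the ratio that [angleS] gives at [m = n - j],
    positive since [j < k <= n]. *)
Lemma angle_binomialS (d n k : nat) : (k <= n)%N ->
  angle_binomial d n.+1 k =
  \prod_(0 <= j < k) ((d + n - j)%:R / (n - j)%:R) * angle_binomial d n k.
Proof.
move=> kn; rewrite /angle_binomial -big_split /= !big_mkord.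
apply: eq_bigr => j _; have jn : (j < n)%N by exact: leq_trans kn.
have nj0 : (n - j)%:R != 0 :> rat by rewrite pnatr_eq0; lia.
rewrite mulrA; congr (_ / _); rewrite mulrAC; apply: (canRL (mulfK nj0)).
rewrite -!natrM; congr _%:R.
rewrite subSn 1?ltnW // mulnC angleS ?subn_gt0 // addnBA //; exact: ltnW.
Qed.

Theorem theorem6 (d n k : nat) (hd : (0 < d)%N) (hn : (0 < n)%N)
    (hk : (k <= n)%N) :
  angle_binomial d n k =
    \det (\matrix_(i < k, j < k) ('C(n + d + j - i - 1, n - 1)%:R : rat)).
Proof.
(* Induction on [n - k] with [k] fixed, so the matrix size never changes. *)
rewrite det_toeplitz_bin // -(subnKC hk); elim: (n - k)%N => [|r IHr].
  by rewrite addn0 angle_binomial_diag det_binmx_diag.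
by rewrite addnS angle_binomialS ?det_binmxS ?leq_addr ?IHr.
Qed.
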